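(* Let $D=D_1\cup\dots\cup D_p\subset(\mathbb{C}^2,0)$ be the germ of a reduced plane curve with irreducible components $D_1,\dots,D_p$ and reduced equation $f\in\mathbb{C}\{x,y\}$. Let $\emptyset\neq J\subseteq\{1,\dots,p\}$ and $D'=\bigcup_{j\in J}D_j$. Renumbering the branches so that $J=\{1,\dots,q\}$ with $q\leqslant p$, one has $$\mathcal{J}_D\cap\big(\{0\}^q\oplus\mathbb{C}\{t_{q+1}\}\oplus\dots\oplus\mathbb{C}\{t_p\}\big)=\{\delta(f): \delta\in\mathrm{Der}(-\log D')\},$$ where $\delta(f)$ denotes its class in $\mathcal{O}_D\subset\mathcal{O}_{\widetilde D}=\bigoplus_{i=1}^p\mathbb{C}\{t_i\}$. In particular, the set of zero divisors of $\mathcal{J}_D$ is determined by the family of modules $\big\{\mathrm{Der}\big(-\log(\bigcup_{j\in J}D_j)\big)\big\}_{J\subset\{1,\dots,p\},\,J\neq\emptyset}$, in that it is the union, over nonempty $J$, of the sets of classes of $\delta(f)$ in $\mathcal{O}_D$ with $\delta\in\mathrm{Der}\big(-\log(\bigcup_{j\in J}D_j)\big)$.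
   Context: $\mathcal{O}_D=\mathbb{C}\{x,y\}/(f)$, and $\mathcal{O}_{\widetilde D}=\bigoplus_{i=1}^p\mathbb{C}\{t_i\}$ is its normalization, where $\mathbb{C}\{t_i\}$ is the normalization of the branch $D_i$. The Jacobian ideal $\mathcal{J}_D\subseteq\mathcal{O}_D$ is the ideal of $\mathcal{O}_D$ generated by the partial derivatives of $f$. For a reduced plane curve germ $E$ with reduced equation $e\in\mathbb{C}\{x,y\}$, $\mathrm{Der}(-\log E)$ is the module of logarithmic vector fields along $E$: germs of holomorphic vector fields $\delta$ on $(\mathbb{C}^2,0)$ with $\delta(e)\in(e)$. *)

(* Defs.v *)
From HB Require Import structures.
From mathcomp Require Import all_boot all_order all_algebra.
From mathcomp Require Import generic_quotient ring_quotient.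
From mathcomp Require Import boolp classical_sets reals.
From mathcomp Require Import complex.

Set Implicit Arguments.
Unset Strict Implicit.
Unset Printing Implicit Defensive.

Import Order.TTheory GRing.Theory Num.Theory.
Local Open Scope ring_scope.
Local Open Scope quotient_scope.
Local Open Scope classical_set_scope.

(* Formal power series in one variable over A.  The type is a wrapper, so that
   its ring structure is the Cauchy product and not the pointwise one. *)
Record fps (A : Type) := Fps { fps_coef :> nat -> A }.

HB.instance Definition _ (A : Type) := gen_eqMixin (fps A).
HB.instance Definition _ (A : Type) := gen_choiceMixin (fps A).

Lemma fpsP (A : Type) (a b : fps A) : (forall i, a i = b i) -> a = b.
Proof. by case: a b => [a] [b] /= /funext ->. Qed.

Section FpsRing.
Variable A : comNzRingType.
Implicit Types a b c : fps A.

Definition fps0 : fps A := Fps (fun=> 0).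
Definition fps_opp a : fps A := Fps (fun i => - a i).
Definition fps_add a b : fps A := Fps (fun i => a i + b i).
Definition fpsC (x : A) : fps A := Fps (fun i => if i == 0%N then x else 0).
Definition fps_mul a b : fps A :=
  Fps (fun i => \sum_(j < i.+1) a j * b (i - j)%N).

Lemma fps_addA : associative fps_add.
Proof. by move=> a b c; apply: fpsP => i /=; rewrite addrA. Qed.
Lemma fps_addC : commutative fps_add.
Proof. by move=> a b; apply: fpsP => i /=; rewrite addrC. Qed.
Lemma fps_add0 : left_id fps0 fps_add.
Proof. by move=> a; apply: fpsP => i /=; rewrite add0r. Qed.
Lemma fps_addN : left_inverse fps0 fps_opp fps_add.
Proof. by move=> a; apply: fpsP => i /=; rewrite addNr. Qed.

HB.instance Definition _ :=
  GRing.isZmodule.Build (fps A) fps_addA fps_addC fps_add0 fps_addN.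

Let trunc n a : {poly A} := \poly_(i < n) a i.

Let coef_mul n a b i : (i < n)%N ->
  (fps_mul a b) i = (trunc n a * trunc n b)`_i.
Proof.
move=> lt_in; rewrite coefM /=; apply: eq_bigr => j _.
rewrite !coef_poly (leq_ltn_trans _ lt_in) 1?(leq_ltn_trans _ lt_in) ?leq_subr //.
by rewrite -ltnS.
Qed.

Let coef_trunc_mul (p q p' q' : {poly A}) i :
    (forall k, (k <= i)%N -> p`_k = p'`_k) ->
    (forall k, (k <= i)%N -> q`_k = q'`_k) ->
  (p * q)`_i = (p' * q')`_i.
Proof.
move=> ep eq; rewrite !coefM; apply: eq_bigr => j _.
by rewrite ep ?eq ?leq_subr // -ltnS.
Qed.

Let trunc_mul n a b k : (k < n)%N ->
  (trunc n (fps_mul a b))`_k = (trunc n a * trunc n b)`_k.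
Proof. by move=> lt_kn; rewrite coef_poly lt_kn (coef_mul a b lt_kn). Qed.

Lemma fps_mulA : associative fps_mul.
Proof.
move=> a b c; apply: fpsP => i; rewrite !(@coef_mul i.+1) //.
rewrite (@coef_trunc_mul _ _ (trunc i.+1 a) (trunc i.+1 b * trunc i.+1 c)) //.
  rewrite mulrA; apply/esym/coef_trunc_mul => // k le_ki.
  by rewrite trunc_mul.
by move=> k le_ki; rewrite trunc_mul.
Qed.

Lemma fps_mulC : commutative fps_mul.
Proof.
by move=> a b; apply: fpsP => i; rewrite !(@coef_mul i.+1) // mulrC.
Qed.

Lemma fps_mul1 : left_id (fpsC 1) fps_mul.
Proof.
move=> a; apply: fpsP => i /=; rewrite big_ord_recl /= mul1r subn0 big1 ?addr0 //.
by move=> j _; rewrite mul0r.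
Qed.

Lemma fps_mulDl : left_distributive fps_mul fps_add.
Proof.
move=> a b c; apply: fpsP => i /=; rewrite -big_split /=.
by apply: eq_bigr => j _; rewrite mulrDl.
Qed.

Lemma fps1_neq0 : fpsC 1 != 0 :> fps A.
Proof.
apply/eqP => /(congr1 (fun a : fps A => a 0%N)) /= /eqP.
by rewrite oner_eq0.
Qed.

HB.instance Definition _ := GRing.Zmodule_isComNzRing.Build (fps A)
  fps_mulA fps_mulC fps_mul1 fps_mulDl fps1_neq0.

Definition fps_deriv a : fps A := Fps (fun i => a i.+1 *+ i.+1).

Lemma fps_coef0 i : (0 : fps A) i = 0. Proof. by []. Qed.
Lemma fps_coef1 i : (1 : fps A) i = (i == 0%N)%:R. Proof. by case: i. Qed.
Lemma fps_coefD a b i : (a + b) i = a i + b i. Proof. by []. Qed.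
Lemma fps_coefN a i : (- a) i = - a i. Proof. by []. Qed.
Lemma fps_coefM a b i : (a * b) i = \sum_(j < i.+1) a j * b (i - j)%N.
Proof. by []. Qed.
Lemma fps_coefMn a n i : (a *+ n) i = a i *+ n.
Proof. by elim: n => // n IH; rewrite !mulrS fps_coefD IH. Qed.
Lemma fps_coef_sum (I : Type) (r : seq I) (P : pred I) (F : I -> fps A) i :
  (\sum_(k <- r | P k) F k) i = \sum_(k <- r | P k) F k i.
Proof. by elim/big_rec2: _ => // k x y _ <-. Qed.

End FpsRing.

(* A series in two variables x, y is a series in x whose coefficients are series
   in y: the coefficient of x^i y^j in u is u i j.  Convergence is absolute
   convergence on some polydisc.  For K complex, the partial order of K makes
   the radius r and the bound M real. *)
Section Convergence.
Variable K : numFieldType.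

Definition cvg_fps1 (a : fps K) : Prop :=
  exists r M : K, 0 < r /\ forall n : nat, \sum_(i < n) `|a i| * r ^+ i <= M.

Definition cvg_fps2 (u : fps (fps K)) : Prop :=
  exists r M : K, 0 < r /\
    forall n : nat, \sum_(i < n) \sum_(j < n) `|u i j| * r ^+ (i + j) <= M.

Definition convergent1 : {pred fps K} := fun a => `[< cvg_fps1 a >].
Definition convergent2 : {pred fps (fps K)} := fun u => `[< cvg_fps2 u >].

Lemma pos_min (r s : K) : 0 < r -> 0 < s ->
  exists t, [/\ 0 < t, t <= r & t <= s].
Proof.
move=> r0 s0; have /orP[rs|sr] : (r <= s) || (s <= r).
- by apply: real_leVge; apply: gtr0_real.
- by exists r.
- by exists s.
Qed.

Lemma sum_widen (F : nat -> K) (n m : nat) : (n <= m)%N ->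
  (forall i, 0 <= F i) -> \sum_(i < n) F i <= \sum_(i < m) F i.
Proof.
move=> nm F0; rewrite -(big_mkord xpredT F) -[leRHS](big_mkord xpredT F).
by rewrite [leRHS](@big_cat_nat _ _ _ n) //= lerDl sumr_ge0.
Qed.

Lemma cauchy_le (F G : nat -> K) (n : nat) :
    (forall i, 0 <= F i) -> (forall i, 0 <= G i) ->
  \sum_(i < n) \sum_(j < i.+1) F j * G (i - j)%N
    <= (\sum_(i < n) F i) * (\sum_(i < n) G i).
Proof.
move=> F0 G0; elim: n => [|n IH]; first by rewrite !big_ord0 mulr0.
have -> : \sum_(i < n.+1) \sum_(j < i.+1) F j * G (i - j)%N =
    \sum_(j < n.+1) F j * \sum_(i < n.+1 - j) G i.
  elim: n.+1 => [|m IHm]; first by rewrite !big_ord0.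
  rewrite big_ord_recr /= IHm [RHS]big_ord_recr /= subSnn big_ord1.
  rewrite [X in _ + X = _]big_ord_recr /= subnn addrA; congr (_ + _).
  rewrite -big_split /=; apply: eq_bigr => j _.
  by rewrite -mulrDr subSn ?(ltnW (ltn_ord j)) // big_ord_recr.
rewrite mulr_suml; apply: ler_sum => j _; apply: ler_wpM2l => //.
by apply: sum_widen => //; rewrite leq_subr.
Qed.

Lemma convergent1_subring : subring_closed convergent1.
Proof.
split.
- apply/asboolP; exists 1, 1; split=> // -[|n]; first by rewrite big_ord0.
  rewrite big_ord_recl big1 ?addr0 /= ?normr1 ?mulr1 //.
  by move=> i _; rewrite normr0 mul0r.
- move=> a b /asboolP[r [M [r0 aM]]] /asboolP[s [N [s0 bN]]].
  have [t [t0 tr ts]] := pos_min r0 s0.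
  apply/asboolP; exists t, (M + N); split=> // n.
  apply: le_trans (lerD (aM n) (bN n)); rewrite -big_split /=.
  apply: ler_sum => i _.
  apply: (@le_trans _ _ ((`|a i| + `|b i|) * t ^+ i)).
    by apply: ler_wpM2r; [exact/exprn_ge0/ltW | exact: ler_normB].
  rewrite mulrDl; apply: lerD; apply: ler_wpM2l => //;
    by apply: lerXn2r => //; rewrite nnegrE ltW.
move=> a b /asboolP[r [M [r0 aM]]] /asboolP[s [N [s0 bN]]].
have [t [t0 tr ts]] := pos_min r0 s0.
have t0' := ltW t0.
apply/asboolP; exists t, (M * N); split=> // n.
have le1 (c : fps K) (q L : K) : t <= q ->
    (forall n, \sum_(i < n) `|c i| * q ^+ i <= L) ->
    \sum_(i < n) `|c i| * t ^+ i <= L.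
  move=> tq cL; apply: le_trans (cL n); apply: ler_sum => i _.
  apply: ler_wpM2l => //; apply: lerXn2r => //; rewrite nnegrE //.
  exact: le_trans tq.
apply: le_trans (ler_pM _ _ (le1 _ _ _ tr aM) (le1 _ _ _ ts bN)); first last.
- by apply: sumr_ge0 => i _; rewrite mulr_ge0 ?exprn_ge0.
- by apply: sumr_ge0 => i _; rewrite mulr_ge0 ?exprn_ge0.
apply: le_trans (cauchy_le (F := fun i => `|a i| * t ^+ i)
  (G := fun i => `|b i| * t ^+ i) n _ _); first last.
- by move=> i; rewrite mulr_ge0 ?exprn_ge0.
- by move=> i; rewrite mulr_ge0 ?exprn_ge0.
apply: ler_sum => i _; rewrite fps_coefM.
apply: le_trans (ler_wpM2r (exprn_ge0 _ t0') (ler_norm_sum _ _ _)) _.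
rewrite mulr_suml; apply: ler_sum => j _.
rewrite normrM mulrACA -exprD subnKC //; by rewrite -ltnS.
Qed.

Lemma convergent2_subring : subring_closed convergent2.
Proof.
have ge0_tm (c : fps (fps K)) t i j : 0 < t -> 0 <= `|c i j| * t ^+ (i + j).
  by move=> t0; rewrite mulr_ge0 ?exprn_ge0 // ltW.
have le1 (c : fps (fps K)) (t q L : K) n : 0 < t -> t <= q ->
    (forall n, \sum_(i < n) \sum_(j < n) `|c i j| * q ^+ (i + j) <= L) ->
    \sum_(i < n) \sum_(j < n) `|c i j| * t ^+ (i + j) <= L.
  move=> t0 tq cL; apply: le_trans (cL n).
  apply: ler_sum => i _; apply: ler_sum => j _; apply: ler_wpM2l => //.
  by apply: lerXn2r => //; rewrite nnegrE ltW // (lt_le_trans t0).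
split.
- apply/asboolP; exists 1, 1; split=> // -[|n]; first by rewrite big_ord0.
  rewrite big_ord_recl [X in _ + X]big1 ?addr0 => [|i _]; last first.
    by apply: big1 => j _; rewrite normr0 mul0r.
  rewrite big_ord_recl big1 ?addr0 /= ?normr1 ?mulr1 //.
  by move=> i _; rewrite normr0 mul0r.
- move=> a b /asboolP[r [M [r0 aM]]] /asboolP[s [N [s0 bN]]].
  have [t [t0 tr ts]] := pos_min r0 s0.
  apply/asboolP; exists t, (M + N); split=> // n.
  apply: le_trans (lerD (le1 _ _ _ _ n t0 tr aM) (le1 _ _ _ _ n t0 ts bN)).
  rewrite -big_split /=; apply: ler_sum => i _.
  rewrite -big_split /=; apply: ler_sum => j _.
  rewrite -mulrDl; apply: ler_wpM2r; first exact/exprn_ge0/ltW.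
  exact: ler_normB.
move=> a b /asboolP[r [M [r0 aM]]] /asboolP[s [N [s0 bN]]].
have [t [t0 tr ts]] := pos_min r0 s0.
apply/asboolP; exists t, (M * N); split=> // n.
apply: le_trans (ler_pM _ _ (le1 _ _ _ _ n t0 tr aM) (le1 _ _ _ _ n t0 ts bN)).
2-3: by do 2![apply: sumr_ge0 => ? _]; exact: ge0_tm.
pose F (c : fps (fps K)) i := \sum_(j < n) `|c i j| * t ^+ (i + j).
have F0 c i : 0 <= F c i by apply: sumr_ge0 => j _; exact: ge0_tm.
apply: le_trans (cauchy_le (F := F a) (G := F b) n (F0 a) (F0 b)).
apply: ler_sum => i _; rewrite /F.
have -> : \sum_(j < n) `|(a * b) i j| * t ^+ (i + j) =
  \sum_(j < n) `|\sum_(k < i.+1) (a k * b (i - k)%N) j| * t ^+ (i + j).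
  by apply: eq_bigr => j _; rewrite (fps_coefM a b i) fps_coef_sum.
apply: (@le_trans _ _ (\sum_(j < n) \sum_(k < i.+1)
    `|(a k * b (i - k)%N) j| * t ^+ (i + j))).
  apply: ler_sum => j _; rewrite -mulr_suml.
  by apply: ler_wpM2r (ler_norm_sum _ _ _); exact/exprn_ge0/ltW.
rewrite exchange_big /=; apply: ler_sum => k _.
apply: le_trans (cauchy_le (F := fun j => `|a k j| * t ^+ (k + j))
  (G := fun j => `|b (i - k)%N j| * t ^+ (i - k + j)) n _ _);
  try by move=> j; exact: ge0_tm.
apply: ler_sum => j _;
apply: le_trans (ler_wpM2r (exprn_ge0 _ (ltW t0)) (ler_norm_sum _ _ _)) _.
rewrite mulr_suml; apply: ler_sum => l _.
rewrite normrM mulrACA -exprD addnACA !subnKC //; by rewrite -ltnS.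
Qed.

HB.instance Definition _ := GRing.isSubringClosed.Build (fps K) convergent1
  convergent1_subring.
HB.instance Definition _ := GRing.isSubringClosed.Build (fps (fps K)) convergent2
  convergent2_subring.

Record cps1 := Cps1 { cps1_val :> fps K; cps1_cvg : cps1_val \in convergent1 }.
Record cps2 :=
  Cps2 { cps2_val :> fps (fps K); cps2_cvg : cps2_val \in convergent2 }.

HB.instance Definition _ := [isSub for cps1_val].
HB.instance Definition _ := [Choice of cps1 by <:].
HB.instance Definition _ := [SubChoice_isSubComNzRing of cps1 by <:].
HB.instance Definition _ := [isSub for cps2_val].
HB.instance Definition _ := [Choice of cps2 by <:].
HB.instance Definition _ := [SubChoice_isSubComNzRing of cps2 by <:].

Lemma convergent_const1 (c : K) : fpsC c \in convergent1.
Proof.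
apply/asboolP; exists 1, `|c|; split=> // -[|n]; first by rewrite big_ord0.
rewrite big_ord_recl big1 ?addr0 /= ?mulr1 // => i _.
by rewrite normr0 mul0r.
Qed.

Lemma convergent_const2 (c : K) : fpsC (fpsC c) \in convergent2.
Proof.
apply/asboolP; exists 1, `|c|; split=> // -[|n]; first by rewrite big_ord0.
rewrite big_ord_recl [X in _ + X]big1 ?addr0 => [|i _]; last first.
  by apply: big1 => j _; rewrite normr0 mul0r.
rewrite big_ord_recl big1 ?addr0 /= ?mulr1 // => i _.
by rewrite normr0 mul0r.
Qed.

Definition cst1 (c : K) : cps1 := Cps1 (convergent_const1 c).
Definition cst2 (c : K) : cps2 := Cps2 (convergent_const2 c).

Let ltn2X i : (i.+1 <= 2 ^ i)%N. Proof. exact: ltn_expl. Qed.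

Let deriv_term (r : K) i j : 0 < r ->
  (r / 2) ^+ (i + j) *+ i.+1 <= r^-1 * r ^+ (i.+1 + j).
Proof.
move=> r0; rewrite addSn exprS mulKf ?gt_eqF // expr_div_n -mulrnAr.
rewrite ger_pMr ?exprn_gt0 // -mulr_natl ler_pdivrMr ?exprn_gt0 // mul1r.
rewrite -natrX ler_nat; apply: leq_trans (ltn2X _) _.
by rewrite leq_exp2l // leq_addr.
Qed.

Let deriv_termC (r : K) i j : 0 < r ->
  (r / 2) ^+ (i + j) *+ j.+1 <= r^-1 * r ^+ (i + j.+1).
Proof. by move=> r0; rewrite addnC [X in r ^+ X]addnC; exact: deriv_term. Qed.

Lemma convergent_dx (u : cps2) : fps_deriv (cps2_val u) \in convergent2.
Proof.
have /asboolP[r [M [r0 uM]]] := cps2_cvg u.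
have T0 i j : 0 <= `|u i j| * r ^+ (i + j).
  by rewrite mulr_ge0 ?exprn_ge0 // ltW.
apply/asboolP; exists (r / 2), (r^-1 * M).
split=> [|n]; first by rewrite divr_gt0.
apply: le_trans (ler_wpM2l _ (uM n.+1)); last by rewrite invr_ge0 ltW.
rewrite big_ord_recl /= mulrDr addrC -[X in X <= _]addr0; apply: lerD; last first.
  by rewrite mulr_ge0 ?sumr_ge0 // invr_ge0 ltW.
rewrite mulr_sumr; apply: ler_sum => i _.
apply: (@le_trans _ _ (r^-1 * \sum_(j < n) `|u i.+1 j| * r ^+ (i.+1 + j))).
  rewrite mulr_sumr; apply: ler_sum => j _.
  rewrite fps_coefMn normrMn mulrnAl -mulrnAr mulrCA.
  by apply: ler_wpM2l => //; exact: deriv_term.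
apply: ler_wpM2l; first by rewrite invr_ge0 ltW.
by apply: (@sum_widen (fun j => `|u i.+1 j| * r ^+ (i.+1 + j))).
Qed.

Lemma convergent_dy (u : cps2) :
  Fps (fun i => fps_deriv (cps2_val u i)) \in convergent2.
Proof.
have /asboolP[r [M [r0 uM]]] := cps2_cvg u.
have T0 i j : 0 <= `|u i j| * r ^+ (i + j).
  by rewrite mulr_ge0 ?exprn_ge0 // ltW.
apply/asboolP; exists (r / 2), (r^-1 * M).
split=> [|n]; first by rewrite divr_gt0.
apply: le_trans (ler_wpM2l _ (uM n.+1)); last by rewrite invr_ge0 ltW.
rewrite big_ord_recr /= mulrDr -[X in X <= _]addr0; apply: lerD; last first.
  by rewrite mulr_ge0 ?sumr_ge0 // invr_ge0 ltW.
rewrite mulr_sumr; apply: ler_sum => i _.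
rewrite big_ord_recl /= mulrDr addrC -[X in X <= _]addr0; apply: lerD; last first.
  by rewrite mulr_ge0 ?T0 // invr_ge0 ltW.
rewrite mulr_sumr; apply: ler_sum => j _.
rewrite normrMn mulrnAl -mulrnAr mulrCA.
by apply: ler_wpM2l => //; exact: deriv_termC.
Qed.

Definition dx (u : cps2) : cps2 := Cps2 (convergent_dx u).
Definition dy (u : cps2) : cps2 := Cps2 (convergent_dy u).

Definition cps2_unit : {pred cps2} := fun u => `[< exists v, v * u = 1 >].

Definition cps2_inv (u : cps2) : cps2 :=
  if pselect (exists v, v * u = 1) is left ex then projT1 (cid ex) else u.

Fact cps2_mulVr : {in cps2_unit, left_inverse 1 cps2_inv *%R}.
Proof.
by move=> u /asboolP ex; rewrite /cps2_inv; case: pselect => // ex'; case: cid.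
Qed.

Fact cps2_unitP (u v : cps2) : v * u = 1 -> u \in cps2_unit.
Proof. by move=> vu; apply/asboolP; exists v. Qed.

Fact cps2_inv_out : {in [predC cps2_unit], cps2_inv =1 id}.
Proof.
move=> u /negP nu; rewrite /cps2_inv; case: pselect => // ex.
by case: nu; apply/asboolP.
Qed.

HB.instance Definition _ := GRing.ComNzRing_hasMulInverse.Build cps2
  cps2_mulVr cps2_unitP cps2_inv_out.

End Convergence.

Section PlaneCurves.
Variable K : numFieldType.
Local Notation "'K{x,y}'" := (cps2 K).
Local Notation "'K{t}'" := (cps1 K).

Definition principal_ideal (e : K{x,y}) : {pred K{x,y}} :=
  fun h => `[< exists g, h = g * e >].

(* The germ at the origin of a reduced plane curve, given by a reduced equation:
   a nonzero series vanishing at 0 that generates a radical ideal. *)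
Record planeCurve := PlaneCurve {
  curve_eqn :> K{x,y};
  curve_eqn_neq0 : curve_eqn != 0;
  curve_eqn_nunit : curve_eqn \isn't a GRing.unit;
  curve_eqn_reduced : forall (h : K{x,y}) (n : nat),
    h ^+ n \in principal_ideal curve_eqn -> h \in principal_ideal curve_eqn }.

Definition curve_ideal (E : planeCurve) : {pred K{x,y}} := principal_ideal E.

Fact curve_ideal_closed E : idealr_closed (curve_ideal E).
Proof.
split.
- by apply/asboolP; exists 0; rewrite mul0r.
- apply/negP => /asboolP[g eg]; have /negP := curve_eqn_nunit E; apply.
  by apply/unitrP; exists g; rewrite [curve_eqn E * g]mulrC -eg.
move=> a u v /asboolP[g ->] /asboolP[h ->].
by apply/asboolP; exists (a * g + h); rewrite mulrDl mulrA.
Qed.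

HB.instance Definition _ E := isIdealr.Build K{x,y} (curve_ideal E)
  (curve_ideal_closed E).

Definition curve_ring (E : planeCurve) := {ideal_quot (curve_ideal E)}.
HB.instance Definition _ E := GRing.ComNzRing.on (curve_ring E).

Definition curve_class (E : planeCurve) (h : K{x,y}) : curve_ring E :=
  \pi_{ideal_quot (curve_ideal E)} h.

Lemma curve_class_eq E (g h : K{x,y}) :
  (curve_class E g == curve_class E h) = (g - h \in curve_ideal E).
Proof. by rewrite Quotient.idealrBE. Qed.

Lemma curve_class_repr E (u : curve_ring E) : curve_class E (repr u) = u.
Proof. exact: reprK. Qed.

Lemma curve_class_zmod_morphism E : zmod_morphism (curve_class E).
Proof. exact: raddfB. Qed.

Lemma curve_class_monoid_morphism E : monoid_morphism (curve_class E).
Proof. by split; [exact: rmorph1 | exact: rmorphM]. Qed.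

HB.instance Definition _ E :=
  GRing.isZmodMorphism.Build _ _ (curve_class E) (curve_class_zmod_morphism E).
HB.instance Definition _ E :=
  GRing.isMonoidMorphism.Build _ _ (curve_class E) (curve_class_monoid_morphism E).

Definition irreducible_curve (E : planeCurve) : Prop :=
  forall a b : K{x,y}, curve_eqn E = a * b ->
    a \is a GRing.unit \/ b \is a GRing.unit.

(* The functions vanishing on a union are those vanishing on every member. *)
Definition is_union (p : nat) (Ds : 'I_p -> planeCurve) (J : {set 'I_p})
    (E : planeCurve) : Prop :=
  forall h : K{x,y},
    h \in curve_ideal E <-> forall j, j \in J -> h \in curve_ideal (Ds j).

Definition irreducible_components (p : nat) (Ds : 'I_p -> planeCurve)
    (D : planeCurve) : Prop :=
  [/\ forall i, irreducible_curve (Ds i),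
      forall i k, curve_ideal (Ds i) =i curve_ideal (Ds k) -> i = k
    & is_union Ds [set: 'I_p]%SET D].

(* K{t} is integrally closed in its fraction field, so an injective K-algebra
   morphism to K{t} is the normalization as soon as it is integral and
   birational, i.e. induces an isomorphism of fraction fields. *)
Definition is_normalization (E : planeCurve)
    (nu : {rmorphism curve_ring E -> K{t}}) : Prop :=
  [/\ injective nu,
      forall c : K, nu (curve_class E (cst2 c)) = cst1 c,
      integralRange nu
    & forall s : K{t}, exists a b : curve_ring E, b != 0 /\ nu b * s = nu a].

(* The direct sum of p copies of K{t} is {ffun 'I_p -> K{t}}.  The choice of a
   representative is immaterial when Ds are components of D, see
   normalization_mapE. *)
Definition normalization_map (p : nat) (D : planeCurve)
    (Ds : 'I_p -> planeCurve)
    (nu : forall i, {rmorphism curve_ring (Ds i) -> K{t}})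
    (u : curve_ring D) : {ffun 'I_p -> K{t}} :=
  [ffun i => nu i (curve_class (Ds i) (repr u))].

Lemma normalization_mapE (p : nat) (D : planeCurve) (Ds : 'I_p -> planeCurve)
    (nu : forall i, {rmorphism curve_ring (Ds i) -> K{t}}) (h : K{x,y}) i :
  is_union Ds [set: 'I_p]%SET D ->
  normalization_map nu (curve_class D h) i = nu i (curve_class (Ds i) h).
Proof.
move=> D_union; rewrite ffunE; congr (nu i _); apply/eqP; rewrite curve_class_eq.
have /D_union : repr (curve_class D h) - h \in curve_ideal D.
  by rewrite -curve_class_eq curve_class_repr.
by apply; rewrite finset.in_setT.
Qed.

(* The vector field d.1 * d/dx + d.2 * d/dy. *)
Definition vfield := (K{x,y} * K{x,y})%type.

Definition vf_app (d : vfield) (h : K{x,y}) : K{x,y} :=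
  d.1 * dx h + d.2 * dy h.

Definition logDer (E : planeCurve) : set vfield :=
  [set d | vf_app d (curve_eqn E) \in curve_ideal E].

Definition jacobian_ideal (D : planeCurve) : set (curve_ring D) :=
  [set u | exists a b : curve_ring D,
     u = a * curve_class D (dx (curve_eqn D)) + b * curve_class D (dy (curve_eqn D))].

(* 0 is a zero divisor. *)
Definition zero_divisor (A : comNzRingType) (u : A) : Prop :=
  exists v : A, v != 0 /\ u * v = 0.

End PlaneCurves.

Arguments jacobian_ideal {K} D _.

(* Main.v *)
Require Import Defs.
From mathcomp Require Import all_boot all_order all_algebra.
From mathcomp Require Import ring_quotient.
From mathcomp Require Import boolp classical_sets reals.
From mathcomp Require Import complex.

Set Implicit Arguments.
Unset Strict Implicit.

Import Order.TTheory GRing.Theory Num.Theory.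
Local Open Scope ring_scope.
Local Open Scope complex_scope.
Local Open Scope classical_set_scope.

(** Write f for the equation of D, f_j for that of D_j and e for that of D'.
    The elements of the Jacobian ideal are the classes of delta(f), and, the
    normalization of each branch being injective, such a class has zero
    components along J exactly when delta(f) lies in every (f_j) with j in J,
    that is, in (e).  So the first assertion amounts to

        delta(f) in (e)  if and only if  delta(e) in (e)   [logDer_unionP].

    Since e divides f, write f = g e, so that delta(f) = g delta(e) + e delta(g),
    and the point is that g is not a zero divisor modulo e.  Each (f_j) is prime,
    because the branch embeds in the domain of convergent series in t, so it
    suffices that f_j does not divide g.  If it did, f_j^2 would divide
    g e = f, which is impossible for a reduced equation
    [reduced_square_free].

    For the second assertion, if delta(f) h lies in (f) with h not in (f), then h
    lies outside some (f_j), so delta(f) lies in that prime ideal, and the first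
    assertion applies to J = {j}.  Conversely, an element of (f_j) is killed
    modulo f by f / f_j, which is not a multiple of f. *)

(** * Formal power series: zero divisors and derivations *)

(** The product of the lowest nonzero terms is the lowest nonzero term of the
    product. *)
Lemma fps_integral (A : comNzRingType) :
  GRing.integral_domain_axiom A -> GRing.integral_domain_axiom (fps A).
Proof.
move=> A_dom a b ab0; apply/norP => -[a_neq0 b_neq0].
have low (c : fps A) : c != 0 ->
    exists2 m, c m != 0 & forall i, (i < m)%N -> c i = 0.
  move=> c_neq0; have exm : exists m, c m != 0.
    apply: contrapT => c_0; case/eqP: c_neq0; apply: fpsP => i.
    by apply/eqP/negPn/negP => ci; case: c_0; exists i.
  case: (ex_minnP exm) => m cm m_min; exists m => // i lt_im.
  by apply/eqP/negPn/negP => /m_min; rewrite leqNgt lt_im.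
have [m am a_lt] := low a a_neq0; have [n bn b_lt] := low b b_neq0.
have /A_dom/norP : a m * b n = 0; last by apply; rewrite am bn.
have := congr1 (fun c : fps A => c (m + n)%N) ab0.
have lt_m : (m < (m + n).+1)%N by rewrite ltnS leq_addr.
rewrite fps_coefM (bigD1 (Ordinal lt_m)) //= addKn big1 ?addr0 // => i neq_im.
have [lt_im|le_mi] := ltnP i m; first by rewrite a_lt ?mul0r.
have lt_mi : (m < i)%N.
  by rewrite ltn_neqAle le_mi andbT eq_sym; move: neq_im; rewrite -val_eqE.
by rewrite b_lt ?mulr0 // ltn_subLR ?ltn_add2r // -ltnS.
Qed.

Lemma fps_derivD (A : comNzRingType) (a b : fps A) :
  fps_deriv (a + b) = fps_deriv a + fps_deriv b.
Proof. by apply: fpsP => i /=; rewrite mulrnDl. Qed.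

Lemma fps_derivM (A : comNzRingType) (a b : fps A) :
  fps_deriv (a * b) = fps_deriv a * b + a * fps_deriv b.
Proof.
apply: fpsP => i; rewrite fps_coefD !fps_coefM /= -sumrMnl.
(* The weight i + 1 splits as j + (i + 1 - j). *)
have -> : \sum_(j < i.+2) (a j * b (i.+1 - j)%N) *+ i.+1 =
    \sum_(j < i.+2) (a j *+ j) * b (i.+1 - j)%N
    + \sum_(j < i.+2) a j * (b (i.+1 - j)%N *+ (i.+1 - j)).
  rewrite -big_split; apply: eq_bigr => j _ /=.
  by rewrite mulrnAl mulrnAr -mulrnDr subnKC // -ltnS.
congr (_ + _).
  by rewrite big_ord_recl mulr0n mul0r add0r; apply: eq_bigr.
rewrite big_ord_recr /= subnn mulr0n mulr0 addr0; apply: eq_bigr => j _.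
by rewrite subSn // -ltnS.
Qed.

(** * Convergent power series *)

Section ConvergentSeries.
Variable K : numFieldType.

Lemma field_integral : GRing.integral_domain_axiom K.
Proof. by move=> x y /eqP; rewrite mulf_eq0. Qed.

Lemma cps1_integral : GRing.integral_domain_axiom (cps1 K).
Proof.
move=> a b /(congr1 val); rewrite rmorphM => /(fps_integral field_integral).
by rewrite -!(inj_eq val_inj) !rmorph0.
Qed.

Lemma cps2_integral : GRing.integral_domain_axiom (cps2 K).
Proof.
move=> a b /(congr1 val); rewrite rmorphM.
move=> /(fps_integral (fps_integral field_integral)).
by rewrite -!(inj_eq val_inj) !rmorph0.
Qed.

Lemma cps2_mulIf (c : cps2 K) : c != 0 -> injective ( *%R^~ c).
Proof.
move=> c_neq0 a b /eqP; rewrite -subr_eq0 -mulrBl => /eqP/cps2_integral.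
by rewrite (negPf c_neq0) orbF subr_eq0 => /eqP.
Qed.

Lemma dxM (u v : cps2 K) : dx (u * v) = dx u * v + u * dx v.
Proof. by apply: val_inj; rewrite /= fps_derivM. Qed.

Lemma dyM (u v : cps2 K) : dy (u * v) = dy u * v + u * dy v.
Proof.
apply: val_inj; apply: fpsP => i /=.
have deriv_sum (I : Type) (r : seq I) (F : I -> fps K) :
    fps_deriv (\sum_(k <- r) F k) = \sum_(k <- r) fps_deriv (F k).
  apply: (big_morph _ (@fps_derivD K)).
  by apply: fpsP => k /=; rewrite mul0rn.
rewrite deriv_sum -big_split.
by apply: eq_bigr => j _ /=; rewrite fps_derivM.
Qed.

Lemma vf_appM (d : vfield K) (u v : cps2 K) :
  vf_app d (u * v) = vf_app d u * v + u * vf_app d v.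
Proof.
by rewrite /vf_app dxM dyM !mulrDr !mulrDl addrACA !mulrA ![u * _]mulrC.
Qed.

End ConvergentSeries.

(** * Plane curves and logarithmic vector fields *)

Section Curves.
Variable K : numFieldType.
Implicit Types E : planeCurve K.

Lemma curve_idealP E (h : cps2 K) :
  reflect (exists g, h = g * curve_eqn E) (h \in curve_ideal E).
Proof. exact: asboolP. Qed.

Lemma mem_curve_eqn E : curve_eqn E \in curve_ideal E.
Proof. by apply/curve_idealP; exists 1; rewrite mul1r. Qed.

Lemma curve_ideal_mull E (a h : cps2 K) :
  h \in curve_ideal E -> a * h \in curve_ideal E.
Proof.
by move=> /curve_idealP[g ->]; apply/curve_idealP; exists (a * g); rewrite mulrA.
Qed.

Lemma curve_class_eq0 E (h : cps2 K) :
  (curve_class E h == 0) = (h \in curve_ideal E).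
Proof. by rewrite -(rmorph0 (curve_class E)) curve_class_eq subr0. Qed.

(** In a proper factorization of the equation, the cofactor survives in the
    ring of the curve: otherwise it could be cancelled, making the other factor
    a unit. *)
Lemma cofactor_notin E (g h : cps2 K) :
  curve_eqn E = g * h -> h \isn't a GRing.unit -> g \notin curve_ideal E.
Proof.
move=> Egh h_nunit; apply/negP => /curve_idealP[k gk].
have g_neq0 : g != 0.
  by apply: contraNneq (curve_eqn_neq0 E) => g0; rewrite Egh g0 mul0r.
have /(cps2_mulIf g_neq0) hk1 : h * k * g = 1 * g.
  by rewrite mul1r -mulrA mulrC -mulrA [g * h]mulrC [h * g]mulrC -Egh -gk.
by case/negP: h_nunit; apply/unitrP; exists k; rewrite mulrC hk1.
Qed.

(** If c^2 g were the equation, the square of c g would lie in the radical ideal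
    of the curve, hence so would c g, although its cofactor is c. *)
Lemma reduced_square_free E (c g : cps2 K) :
  curve_eqn E = g * c * c -> c \is a GRing.unit.
Proof.
move=> Egcc; apply/negPn/negP => /(cofactor_notin Egcc)/negP; apply.
apply: (curve_eqn_reduced (n := 2)); apply/curve_idealP; exists g.
by rewrite Egcc expr2 -!mulrA [c * (g * c)]mulrCA.
Qed.

(** A subring of the domain of convergent series in one variable is a domain. *)
Lemma embedded_curve_prime E (nu : {rmorphism curve_ring E -> cps1 K}) :
  injective nu -> prime_idealr_closed (curve_ideal E).
Proof.
move=> nu_inj u v; rewrite -!curve_class_eq0 rmorphM => /eqP uv0.
have := congr1 nu uv0; rewrite rmorphM rmorph0 => /cps1_integral.
by rewrite -(rmorph0 nu) !(inj_eq nu_inj).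
Qed.

Lemma jacobian_idealP E (u : curve_ring E) :
  jacobian_ideal E u <->
    exists d : vfield K, u = curve_class E (vf_app d (curve_eqn E)).
Proof.
split=> [[a [b ->]]|[d ->]].
  exists (repr a, repr b).
  by rewrite /vf_app /= rmorphD !rmorphM /= !curve_class_repr.
exists (curve_class E d.1), (curve_class E d.2).
by rewrite /vf_app rmorphD !rmorphM.
Qed.

Section Union.
Context {p : nat} {D : planeCurve K} {Ds : 'I_p -> planeCurve K}.
Hypothesis D_union : is_union Ds [set: 'I_p]%SET D.
Hypothesis Ds_prime : forall j, prime_idealr_closed (curve_ideal (Ds j)).

Lemma curve_ideal_sub (j : 'I_p) (h : cps2 K) :
  h \in curve_ideal D -> h \in curve_ideal (Ds j).
Proof. by move=> /D_union; apply; rewrite finset.in_setT. Qed.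

(** The equation of D is g e, where e is the equation of D', so a vector field
    d maps it to g d(e) modulo e; and g is not in any of the primes whose
    intersection is generated by e, since D is reduced. *)
Lemma logDer_unionP (J : {set 'I_p}) (D' : planeCurve K) (d : vfield K) :
  is_union Ds J D' ->
  logDer D' d <-> vf_app d (curve_eqn D) \in curve_ideal D'.
Proof.
move=> D'_union; rewrite /logDer /=.
have /curve_idealP[g fge] : curve_eqn D \in curve_ideal D'.
  by apply/D'_union => j _; apply: curve_ideal_sub; apply: mem_curve_eqn.
have dge : vf_app d g * curve_eqn D' \in curve_ideal D'.
  by apply: curve_ideal_mull; apply: mem_curve_eqn.
rewrite fge vf_appM; split=> [de|]; first by rewrite rpredD // curve_ideal_mull.
rewrite rpredDl // => gde; apply/D'_union => j jJ.
have /D'_union/(_ j jJ)/Ds_prime/orP[|//] := gde.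
have /D'_union/(_ j jJ)/curve_idealP[e' ee'] := mem_curve_eqn D'.
case/curve_idealP=> g' gg'.
have /reduced_square_free fj_unit :
    curve_eqn D = g' * e' * curve_eqn (Ds j) * curve_eqn (Ds j).
  by rewrite fge ee' gg' -!mulrA; congr (_ * _); rewrite mulrCA.
by have := curve_eqn_nunit (Ds j); rewrite fj_unit.
Qed.

(** Modulo the equation f of D, a function vanishing on the branch D_j is killed by
    the cofactor of f_j in f; conversely, a nonzero class is nonzero on some
    branch, and there it can be cancelled. *)
Lemma zero_divisor_branchP (h : cps2 K) :
  zero_divisor (curve_class D h) <-> exists j, h \in curve_ideal (Ds j).
Proof.
split=> [[v [v_neq0 hv0]]|[j /curve_idealP[k hk]]].
  have v_out : repr v \notin curve_ideal D.
    by rewrite -curve_class_eq0 curve_class_repr.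
  have hv_in : h * repr v \in curve_ideal D.
    by rewrite -curve_class_eq0 rmorphM /= curve_class_repr hv0.
  apply: contrapT => no_j; case/negP: v_out; apply/D_union => j _.
  have /Ds_prime/orP[hj|//] := curve_ideal_sub j hv_in.
  by case: no_j; exists j.
have /curve_idealP[g fg] := curve_ideal_sub j (mem_curve_eqn D).
exists (curve_class D g); split.
  by rewrite curve_class_eq0 (cofactor_notin fg) // curve_eqn_nunit.
apply/eqP; rewrite -rmorphM curve_class_eq0; apply/curve_idealP; exists k.
by rewrite hk fg -mulrA [_ * g]mulrC.
Qed.

End Union.

End Curves.

Theorem proposition3p18 (R : realType) (p : nat)
    (D : planeCurve R[i]) (Ds : 'I_p -> planeCurve R[i])
    (nu : forall i : 'I_p, {rmorphism curve_ring (Ds i) -> cps1 R[i]})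
    (D_components : irreducible_components Ds D)
    (nu_normalization : forall i : 'I_p, is_normalization (nu i)) :
  (forall (J : {set 'I_p}) (D' : planeCurve R[i]),
     J != finset.set0 -> is_union Ds J D' ->
     [set normalization_map nu u | u in jacobian_ideal D]
       `&` [set w : {ffun 'I_p -> cps1 R[i]} | forall j, j \in J -> w j = 0]
     = [set normalization_map nu (curve_class D (vf_app d (curve_eqn D)))
         | d in logDer D'])
  /\
  (forall D' : {set 'I_p} -> planeCurve R[i],
     (forall J : {set 'I_p}, J != finset.set0 -> is_union Ds J (D' J)) ->
     [set u : curve_ring D | jacobian_ideal D u /\ zero_divisor u]
     = \bigcup_(J in [set J : {set 'I_p} | J != finset.set0])
         [set curve_class D (vf_app d (curve_eqn D)) | d in logDer (D' J)]).
Proof.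
have [_ _ D_union] := D_components.
have nu_inj j : injective (nu j) by case: (nu_normalization j).
have Ds_prime j : prime_idealr_closed (curve_ideal (Ds j)).
  exact: embedded_curve_prime (nu_inj j).
have nmap_eq0 (h : cps2 R[i]) j :
    normalization_map nu (curve_class D h) j = 0 <-> h \in curve_ideal (Ds j).
  rewrite normalization_mapE // -curve_class_eq0 -(rmorph0 (nu j)).
  by split=> [/nu_inj/eqP | /eqP ->].
split=> [J D' _ D'_union|D' D'_union].
  apply/seteqP; split=> [w [[u /jacobian_idealP[d ->] <-] w0]|w [d d_log <-]].
    exists d => //; apply/(logDer_unionP D_union Ds_prime d D'_union)/D'_union.
    by move=> j jJ; apply/nmap_eq0/w0.
  split.
    exists (curve_class D (vf_app d (curve_eqn D))) => //.
    by apply/jacobian_idealP; exists d.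
  move=> j jJ; apply/nmap_eq0; move: j jJ; apply/D'_union.
  exact/(logDer_unionP D_union Ds_prime d D'_union).
apply/seteqP; split=> [u [/jacobian_idealP[d ->]]|u [J /= J_neq0 [d d_log <-]]].
  case/(zero_divisor_branchP D_union Ds_prime) => j dfj.
  have j_neq0 : [set j]%SET != finset.set0 by apply/set0Pn; exists j; rewrite inE.
  exists [set j]%SET => //; exists d => //.
  apply/(logDer_unionP D_union Ds_prime d (D'_union _ j_neq0)).
  by apply/(D'_union _ j_neq0) => k; rewrite inE => /eqP ->.
split; first by apply/jacobian_idealP; exists d.
have [j jJ] := set0Pn _ J_neq0.
apply/(zero_divisor_branchP D_union Ds_prime); exists j.
apply: (D'_union J J_neq0 _).1 jJ.
exact/(logDer_unionP D_union Ds_prime d (D'_union J J_neq0)).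
Qed.
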